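(* Let $n \geq 1$ and $d \in \mathbb{N}$, and let $\mathcal{X}, \mathcal{Y} \subseteq [-1,1]^n$ be finite sample sets that are non-degenerate up to degree $d$, with empirical measures $\mu_{\mathcal{X}}, \mu_{\mathcal{Y}}$ and associated Christoffel polynomials $P^{\mu_{\mathcal{X}}}_d$, $P^{\mu_{\mathcal{Y}}}_d$ of degree parameter $d$. Write $C_{n,d} := 4 \cdot s(n,d) \cdot d^2$, where $s(n,d) := \dim \mathbb{R}[\mathbf{x}]_d = \binom{n+d}{d}$. Then for all $\mathbf{x} \in \mathbb{R}^n$, $$|P^{\mu_{\mathcal{X}}}_d(\mathbf{x}) - P^{\mu_{\mathcal{Y}}}_d(\mathbf{x})| \leq C_{n,d} \cdot \|P^{\mu_{\mathcal{X}}}_d\|_\infty \cdot d_W(\mu_{\mathcal{X}}, \mu_{\mathcal{Y}}) \cdot P^{\mu_{\mathcal{Y}}}_d(\mathbf{x}).$$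
   Context: $\mathbb{R}[\mathbf{x}]_d$ is the space of real polynomials in $n$ variables of total degree at most $d$. For a finite sample set $\mathcal{X}$ consisting of samples $X_1,\dots,X_N$, the empirical measure is $\mu_{\mathcal{X}} = \frac1N\sum_{i=1}^N \delta_{X_i}$, and $\langle p,q\rangle_{\mu_{\mathcal{X}}} := \frac1N\sum_{i=1}^N p(X_i)q(X_i)$. The sample set $\mathcal{X}$ is non-degenerate up to degree $d$ if $\langle\cdot,\cdot\rangle_{\mu_{\mathcal{X}}}$ is positive definite on $\mathbb{R}[\mathbf{x}]_d$ (i.e. no nonzero polynomial of degree at most $d$ vanishes on all samples). In that case, for any orthonormal basis $(b_\alpha)_{|\alpha|\le d}$ of $(\mathbb{R}[\mathbf{x}]_d, \langle\cdot,\cdot\rangle_{\mu_{\mathcal{X}}})$, the Christoffel polynomial is $P^{\mu_{\mathcal{X}}}_d(\mathbf{x}) := \sum_{|\alpha|\le d} b_\alpha(\mathbf{x})^2$ (independent of the choice of basis). Supremum norm: $\|f\|_\infty := \max_{\mathbf{x}\in[-1,1]^n}|f(\mathbf{x})|$. Wasserstein distance: for probability measures $\mu_{\mathcal{X}},\mu_{\mathcal{Y}}$ with finite supports $\mathcal{X},\mathcal{Y}$, $d_W(\mu_{\mathcal{X}},\mu_{\mathcal{Y}})$ is the minimum of $\sum_{\mathbf{x}\in\mathcal{X},\mathbf{y}\in\mathcal{Y}}\gamma(\mathbf{x},\mathbf{y})\|\mathbf{x}-\mathbf{y}\|_2$ over all $\gamma:\mathcal{X}\times\mathcal{Y}\to\mathbb{R}_{\ge0}$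 with $\sum_{\mathbf{y}}\gamma(\mathbf{x},\mathbf{y})=\mu_{\mathcal{X}}(\mathbf{x})$ for all $\mathbf{x}\in\mathcal{X}$ and $\sum_{\mathbf{x}}\gamma(\mathbf{x},\mathbf{y})=\mu_{\mathcal{Y}}(\mathbf{y})$ for all $\mathbf{y}\in\mathcal{Y}$. *)

(* Defs.v *)
From mathcomp Require Import all_boot all_order all_algebra.
From mathcomp Require Import boolp classical_sets reals.
From mathcomp Require Import mpoly.

Set Implicit Arguments.
Unset Strict Implicit.
Unset Printing Implicit Defensive.
Import Order.TTheory GRing.Theory Num.Theory.

Local Open Scope classical_set_scope.
Local Open Scope ring_scope.

(* A sample is the list X_1, ..., X_N of its points; repetitions are allowed,
   and a sample that is a set is a duplicate-free list.  [msize p <= d.+1]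
   says that the total degree of [p] is at most [d] (with [msize 0 = 0]). *)

Definition mpeval (R : realType) (n : nat) (p : {mpoly R[n]})
    (x : 'rV[R]_n) : R :=
  p.@[x ord0].

Definition cube (R : realType) (n : nat) : set 'rV[R]_n :=
  [set x | forall i, -1 <= x ord0 i <= 1].

(* The supremum is attained: the cube is compact and nonempty. *)
Definition supnorm (R : realType) (n : nat) (p : {mpoly R[n]}) : R :=
  sup [set `|mpeval p x| | x in @cube R n].

Definition norm2 (R : realType) (n : nat) (x : 'rV[R]_n) : R :=
  Num.sqrt (\sum_i x ord0 i ^+ 2).

(* mass given to the point [x] by the empirical measure of [X] *)
Definition empirical (R : realType) (n : nat) (X : seq 'rV[R]_n)
    (x : 'rV[R]_n) : R :=
  (size X)%:R^-1 * \sum_(y <- X) (y == x)%:R.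

Definition inner (R : realType) (n : nat) (X : seq 'rV[R]_n)
    (p q : {mpoly R[n]}) : R :=
  (size X)%:R^-1 * \sum_(x <- X) mpeval p x * mpeval q x.

Definition nondegenerate_sample (R : realType) (n : nat) (X : seq 'rV[R]_n)
    (d : nat) : Prop :=
  forall p : {mpoly R[n]}, (msize p <= d.+1)%N -> p != 0 -> 0 < inner X p p.

(* The index type ['X_{1..n < d.+1}] is the set of alpha with |alpha| <= d. *)
Definition orthonormal_basis (R : realType) (n : nat) (X : seq 'rV[R]_n)
    (d : nat) (b : 'X_{1..n < d.+1} -> {mpoly R[n]}) : Prop :=
  [/\ forall a, (msize (b a) <= d.+1)%N,
      forall a a', inner X (b a) (b a') = (a == a')%:R
    & forall p : {mpoly R[n]}, (msize p <= d.+1)%N ->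
        exists c : 'X_{1..n < d.+1} -> R, p = \sum_a c a *: b a].

(* The default value 0 is only taken when there is no orthonormal basis: see
   [orthonormal_basis_exists] and [christoffelE]. *)
Definition christoffel (R : realType) (n : nat) (X : seq 'rV[R]_n)
    (d : nat) : {mpoly R[n]} :=
  xget 0 [set P | exists2 b : 'X_{1..n < d.+1} -> {mpoly R[n]},
                    orthonormal_basis X b & P = \sum_a b a ^+ 2].

(* [S] and [T] are duplicate-free lists of the points of the supports. *)
Definition coupling (R : realType) (n : nat) (S T : seq 'rV[R]_n)
    (mu nu : 'rV[R]_n -> R) (g : 'rV[R]_n -> 'rV[R]_n -> R) : Prop :=
  [/\ {in S & T, forall x y, 0 <= g x y},
      {in S, forall x, \sum_(y <- T) g x y = mu x}
    & {in T, forall y, \sum_(x <- S) g x y = nu y}].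

Definition transport_cost (R : realType) (n : nat) (S T : seq 'rV[R]_n)
    (g : 'rV[R]_n -> 'rV[R]_n -> R) : R :=
  \sum_(x <- S) \sum_(y <- T) g x y * norm2 (x - y).

(* The infimum is attained (nonempty compact polytope of couplings) as soon as
   [X] and [Y] are nonempty, in particular when they are nondegenerate. *)
Definition wasserstein (R : realType) (n : nat) (X Y : seq 'rV[R]_n) : R :=
  inf [set transport_cost (undup X) (undup Y) g
      | g in [set g | coupling (undup X) (undup Y)
                        (empirical X) (empirical Y) g]].

Lemma inner_sym (R : realType) n (X : seq 'rV[R]_n) (p q : {mpoly R[n]}) :
  inner X p q = inner X q p.
Proof. by rewrite /inner; under eq_bigr do rewrite mulrC. Qed.

Lemma inner_lin (R : realType) n (X : seq 'rV[R]_n) (q : {mpoly R[n]}) a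
    (p p' : {mpoly R[n]}) :
  inner X (a *: p + p') q = a * inner X p q + inner X p' q.
Proof.
rewrite /inner mulrCA -mulrDr; congr (_ * _).
rewrite mulr_sumr -big_split /=.
by apply: eq_bigr => x _; rewrite /mpeval mevalD mevalZ mulrDl mulrA.
Qed.

Lemma inner_suml (R : realType) n (X : seq 'rV[R]_n) (q : {mpoly R[n]})
    (I : Type) (r : seq I) (c : I -> R) (b : I -> {mpoly R[n]}) :
  inner X (\sum_(i <- r) c i *: b i) q = \sum_(i <- r) c i * inner X (b i) q.
Proof.
elim: r => [|i r IH]; last by rewrite !big_cons inner_lin IH.
rewrite !big_nil /inner big1 ?mulr0 // => x _.
by rewrite /mpeval meval0 mul0r.
Qed.

Lemma orthonormal_coord (R : realType) n (X : seq 'rV[R]_n) d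
    (b : 'X_{1..n < d.+1} -> {mpoly R[n]}) (p : {mpoly R[n]}) :
  orthonormal_basis X b -> (msize p <= d.+1)%N ->
  p = \sum_a inner X p (b a) *: b a.
Proof.
move=> [_ ob sb] /sb[c ->]; apply: eq_bigr => a _.
rewrite inner_suml (bigD1 a) //= big1 => [|a' /negPf aa'].
  by rewrite ob eqxx mulr1 addr0.
by rewrite ob aa' mulr0.
Qed.

Lemma christoffelE (R : realType) n (X : seq 'rV[R]_n) d
    (b : 'X_{1..n < d.+1} -> {mpoly R[n]}) :
  orthonormal_basis X b -> christoffel X d = \sum_a b a ^+ 2.
Proof.
move=> bb; rewrite /christoffel; case: xgetP => [P _ [c cc ->]|]; last first.
  by move=> /(_ (\sum_a b a ^+ 2)) []; exists b.
have [bd _ _] := bb; have [cd _ _] := cc.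
under eq_bigr => a _ do
  rewrite expr2 {1}(orthonormal_coord bb (cd a)) mulr_suml.
rewrite exchange_big /=; apply: eq_bigr => a _.
rewrite expr2 {4}(orthonormal_coord cc (bd a)) mulr_sumr.
by apply: eq_bigr => a' _; rewrite inner_sym -scalerAl -scalerAr mulrC.
Qed.

Lemma orthonormal_basis_exists (R : realType) n (X : seq 'rV[R]_n) d :
  nondegenerate_sample X d ->
  exists b : 'X_{1..n < d.+1} -> {mpoly R[n]}, orthonormal_basis X b.
Proof.
move=> nX.
pose I : finType := 'X_{1..n < d.+1}.
pose out (s : seq I) (p : {mpoly R[n]}) :=
  (msize p <= d.+1)%N /\ forall a : I, a \notin s -> p@_a = 0.
have outD s p q c : out s p -> out s q -> out s (c *: p + q).
  move=> [dp zp] [dq zq]; split=> [|a sa].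
    rewrite (leq_trans (msizeD_le _ _)) // geq_max dq andbT.
    exact: leq_trans (msizeZ_le _ _) dp.
  by rewrite mcoeffD mcoeffZ zp // zq // mulr0 addr0.
have out0 s : out s 0 by split=> [|a _]; rewrite ?msize0 ?mcoeff0.
have outS s (b : I -> {mpoly R[n]}) (r : seq I) (c : I -> R) :
    {in r, forall a, out s (b a)} -> out s (\sum_(a <- r) c a *: b a).
  move=> h; rewrite big_seq; elim/big_ind: _ => [|p q hp hq|a ra].
  - exact: out0.
  - by rewrite -[p]scale1r; apply: outD.
  - by rewrite -[_ *: _]addr0; apply: outD; [exact: h|exact: out0].
have key (s : seq I) : uniq s -> exists b : I -> {mpoly R[n]},
  [/\ {in s, forall a, out s (b a)},
      {in s &, forall a a', inner X (b a) (b a') = (a == a')%:R}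
    & forall p, out s p -> exists c : I -> R, p = \sum_(a <- s) c a *: b a].
  elim: s => [_|a0 s IH /= /andP[as0 us]].
    exists (fun=> 0); split=> // p [dp zp]; exists (fun=> 0).
    rewrite big_nil; apply/mpolyP => m; rewrite mcoeff0.
    have [md|md] := ltnP (mdeg m) d.+1; first exact: (zp (BMultinom md)).
    exact: (memN_msupp_eq0 (msize_mdeg_ge (leq_trans dp md))).
  have [b [ob nb sb]] := IH us.
  have sub p : out s p -> out (a0 :: s) p.
    move=> [dp zp]; split=> // a; rewrite inE negb_or => /andP[_]; exact: zp.
  have oX : out (a0 :: s) 'X_[a0].
    split; first by rewrite msizeX bmdeg.
    move=> a; rewrite inE negb_or eq_sym => /andP[/negPf h _].
    by rewrite mcoeffX; move: h; rewrite -val_eqE /= => ->.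
  pose q : {mpoly R[n]} := \sum_(a <- s) (- inner X 'X_[a0] (b a)) *: b a.
  have oq : out s q by apply: outS.
  pose r : {mpoly R[n]} := 'X_[a0] + q.
  have outr : out (a0 :: s) r.
    by rewrite /r -['X_[_]]scale1r; apply: outD => //; exact: sub.
  have r1 : r@_a0 = 1.
    by rewrite mcoeffD mcoeffX eqxx (proj2 oq) // addr0.
  have rN0 : r != 0.
    by apply: contra_eqN r1 => /eqP ->; rewrite mcoeff0 eq_sym oner_eq0.
  have rgt0 : 0 < inner X r r by apply: nX => //; case: outr.
  have rb : {in s, forall a, inner X r (b a) = 0}.
    move=> a sa; rewrite /r -['X_[_]]scale1r inner_lin mul1r inner_suml.
    rewrite (bigD1_seq a) //= nb // eqxx mulr1 big_seq_cond big1.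
      by rewrite addr0 subrr.
    by move=> a' /andP[sa' /negPf aa']; rewrite nb // aa' mulr0.
  pose k := Num.sqrt (inner X r r).
  have k0 : k != 0 by rewrite sqrtr_eq0 -ltNge.
  have inZ c p p' : inner X (c *: p) p' = c * inner X p p'.
    have := inner_suml X p' [:: tt] (fun=> c) (fun=> p).
    by rewrite !big_seq1.
  exists (fun a => if a == a0 then k^-1 *: r else b a); split.
  - move=> a; rewrite inE; case: eqP => [_ _|_ /= sa].
      by rewrite -[_ *: _]addr0; apply: outD.
    exact/sub/ob.
  - have N0 a : a \in s -> a != a0 by apply: contraTneq => ->.
    move=> a a'; rewrite !inE.
    case: eqVneq => [->|aa0]; case: eqVneq => [->|a'a0] //= sa sa'.
    + rewrite inZ inner_sym inZ mulrA -invfM -expr2 sqr_sqrtr ?ltW //.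
      by rewrite mulVf ?gt_eqF.
    + by rewrite inZ rb // mulr0.
    + by rewrite inner_sym inZ rb // mulr0 (negPf aa0).
    + exact: nb.
  - move=> p op.
    have [|c pc] := sb (- p@_a0 *: r + p).
      have [h1 h2] := outD _ _ _ (- p@_a0) outr op; split=> // a sa.
      have [->|aa0] := eqVneq a a0.
        by rewrite mcoeffD mcoeffZ r1 mulr1 addNr.
      by apply: h2; rewrite inE negb_or aa0.
    exists (fun a => if a == a0 then k * p@_a0 else c a).
    rewrite big_cons eqxx scalerA mulrAC mulfV // mul1r.
    rewrite [X in _ + X](_ : _ = \sum_(a <- s) c a *: b a).
      by rewrite -pc scaleNr addrA subrr add0r.
    rewrite big_seq [RHS]big_seq; apply: eq_bigr => a sa.
    by case: eqP sa as0 => // -> ->.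
have [b [ob nb sb]] := key (enum I) (enum_uniq _).
exists b; split.
- by move=> a; have [] := ob a (mem_enum _ _).
- by move=> a a'; apply: nb; rewrite mem_enum.
- move=> p dp; have [|c ->] := sb p; first by split=> // a; rewrite mem_enum.
  by exists c; rewrite big_enum.
Qed.

(* Main.v *)
Require Import Defs.
From mathcomp Require Import all_boot all_order all_algebra.
From mathcomp Require Import boolp classical_sets reals.
From mathcomp Require Import mpoly.
From mathcomp Require Import trigo.
From mathcomp Require Import ring lra zify.

Set Implicit Arguments.
Unset Strict Implicit.
Unset Printing Implicit Defensive.
Import Order.TTheory GRing.Theory Num.Theory.
Local Open Scope ring_scope.

(* Let [K_X], [K_Y] be the reproducing kernels at [x].  Since [q(x)^2 <=
   <q,q>_Y P_Y(x)] for every [q] of degree at most [d], with [q = K_X] and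
   vice versa, an estimate [|<q,q>_X - <q,q>_Y| <= e <q,q>_X] gives
   [|P_X(x) - P_Y(x)| <= e P_Y(x)].  To obtain it, transport [q^2] along a
   coupling: [q^2 <= <q,q>_X P_X <= <q,q>_X |P_X|_oo] on the cube, so only a
   Lipschitz constant of [q] is needed.  Moving one coordinate at a time reduces
   this to a univariate Markov inequality.  The sharp constant [d^2] is not
   needed: the factor ['C(n + d, d) >= n d] leaves room for the bound [2 d^3],
   which follows from the Chebyshev expansion [q(cos t) = \sum_l a_l cos(l t)],
   as [|a_l| <= 2 |q|_oo] and [|cos l s - cos l t| <= l^2 |cos s - cos t|]. *)

(** * Lipschitz bounds for cosine sums *)

Lemma normr_sin_natmul (R : realType) (k : nat) (t : R) :
  `|sin (k%:R * t)| <= k%:R * `|sin t|.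
Proof.
elim: k => [|k IH]; first by rewrite !mul0r sin0 normr0.
rewrite -natr1 mulrDl mul1r sinD (le_trans (ler_normD _ _)) // mulrDl mul1r.
rewrite lerD // normrM.
  exact: le_trans (ler_piMr (normr_ge0 _) (cos_max _)) IH.
exact: ler_piMl (normr_ge0 _) (cos_max _).
Qed.

(** Sum-to-product writes each difference as [-2] times the sines of the half-sum and
    half-difference; each of these two sines costs one factor [k]. *)
Lemma normr_cos_natmulB (R : realType) (k : nat) (s t : R) :
  `|cos (k%:R * s) - cos (k%:R * t)| <= k%:R ^+ 2 * `|cos s - cos t|.
Proof.
have E u v : cos u - cos v = - 2 * (sin ((u + v) / 2) * sin ((u - v) / 2)) :> R.
  have -> : cos u = cos ((u + v) / 2 + (u - v) / 2) by congr cos; field.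
  have -> : cos v = cos ((u + v) / 2 - (u - v) / 2) by congr cos; field.
  by rewrite cosD cosB; ring.
rewrite !E -mulrDr -mulrBr -!mulrA !normrM.
rewrite [k%:R * (`|-2| * _)]mulrCA [leRHS]mulrCA ler_wpM2l // [leRHS]mulrA mulrACA.
by apply: ler_pM; rewrite ?normr_ge0 ?normr_sin_natmul.
Qed.

(** This is the real part of a vanishing geometric sum of [N]-th roots of unity. The condition
    [0 < k < N] puts [h = k pi / N] strictly between 0 and [pi], so [sin h] can be cancelled. *)
Lemma sum_cos_nodes (R : realType) (N k : nat) : (0 < k < N)%N ->
  \sum_(0 <= j < N) cos (k%:R * (j%:R * (2 * pi / N%:R))) = 0 :> R.
Proof.
move=> /andP[k0 kN].
have N1 : (0 < N)%N := leq_ltn_trans (leq0n k) kN.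
have N0 : (0 : R) < N%:R by rewrite ltr0n.
pose h : R := k%:R * pi / N%:R.
have sh : 2 * sin h != 0.
  rewrite mulf_neq0 ?pnatr_eq0 // gt_eqF // sin_gt0_pi //.
  rewrite /h divr_gt0 ?mulr_gt0 ?pi_gt0 ?ltr0n //=.
  by rewrite ltr_pdivrMr // [ltRHS]mulrC ltr_pM2r ?pi_gt0 // ltr_nat.
(* [2 sin h cos (2 j h) = sin ((2 j + 1) h) - sin ((2 j - 1) h)] telescopes. *)
apply: (mulfI sh); rewrite mulr0 mulr_sumr.
pose f (j : nat) : R := sin ((2 * j%:R) * h - h).
rewrite (eq_bigr (fun j => f j.+1 - f j)); last first.
  move=> j _; rewrite /f.
  have -> : k%:R * (j%:R * (2 * pi / N%:R)) = 2 * j%:R * h by rewrite /h; ring.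
  have -> : 2 * j.+1%:R * h - h = 2 * j%:R * h + h by rewrite -natr1; ring.
  by rewrite sinD sinB; ring.
rewrite telescope_sumr // /f mulr0 mul0r.
(* Since [2 N h = 2 pi k], the two ends of the telescope differ by [k] full periods. *)
have -> : 2 * N%:R * h - h = (0 - h) + (pi *+ 2) *+ k.
  rewrite -[_ *+ k]mulr_natl -[pi *+ 2]mulr_natl /h; field.
  by rewrite gt_eqF.
by rewrite (periodicn (@sinD2pi R)) subrr.
Qed.

(** Product-to-sum leaves the frequencies [k + l] and [k - l], of absolute value at most [2 d],
    hence below the number [2 d + 1] of nodes. Only frequency zero, that is [k = l], contributes. *)
Lemma sum_cosM_nodes (R : realType) (d k l : nat) :
    (0 < k <= d)%N -> (l <= d)%N ->
  \sum_(0 <= j < d.*2.+1)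
     cos (k%:R * (j%:R * (2 * pi / d.*2.+1%:R))) *
     cos (l%:R * (j%:R * (2 * pi / d.*2.+1%:R))) =
  (k == l)%:R * (d.*2.+1%:R / 2) :> R.
Proof.
move=> /andP[k0 kd] ld.
set N := d.*2.+1; set th := fun j : nat => j%:R * (2 * pi / N%:R) : R.
have cosM u v : cos u * cos v = 2^-1 * (cos (u + v) + cos (u - v)) :> R.
  by rewrite cosD cosB; field.
under eq_bigr => j _ do rewrite -/(th j) cosM -mulrDl -mulrBl -natrD.
rewrite -mulr_sumr big_split /= sum_cos_nodes; last by rewrite /N; lia.
rewrite add0r; have [->|kl] := eqVneq k l.
  under eq_bigr => j _ do rewrite subrr mul0r cos0.
  by rewrite sumr_const_nat subn0 mul1r mulrC.
rewrite mul0r; case: (ltngtP k l) kl => // kl _.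
  under eq_bigr => j _ do rewrite -opprB mulNr cosN -natrB 1?ltnW //.
  by rewrite sum_cos_nodes ?mulr0 // /N; lia.
under eq_bigr => j _ do rewrite -natrB 1?ltnW //.
by rewrite sum_cos_nodes ?mulr0 // /N; lia.
Qed.

(* The coefficients are recovered by discrete orthogonality at the [2 d + 1]
   equidistant nodes. *)
Lemma cos_coef_le (R : realType) (d : nat) (a : nat -> R) (M : R) :
    (forall t, `|\sum_(l < d.+1) a l * cos (l%:R * t)| <= M) ->
  forall k, (0 < k <= d)%N -> `|a k| <= 2 * M.
Proof.
move=> FM k kd; pose N := d.*2.+1.
pose th (j : nat) : R := j%:R * (2 * pi / N%:R).
have N0 : (0 : R) < N%:R by rewrite ltr0n.
have E : a k * (N%:R / 2) = \sum_(0 <= j < N)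
    (\sum_(l < d.+1) a l * cos (l%:R * th j)) * cos (k%:R * th j).
  under eq_bigr => j _ do rewrite mulr_suml.
  rewrite exchange_big /=.
  have kd1 : (k < d.+1)%N by case/andP: kd.
  rewrite (bigD1 (Ordinal kd1)) //= [X in _ + X]big1 => [|l lk].
    under eq_bigr => j _ do rewrite -mulrA.
    by rewrite -mulr_sumr sum_cosM_nodes ?eqxx ?mul1r ?addr0.
  under eq_bigr => j _ do rewrite -mulrA [cos _ * cos _]mulrC.
  rewrite -mulr_sumr sum_cosM_nodes // ?(leq_ord l) //.
  by move: lk; rewrite -val_eqE /= eq_sym => /negPf ->; rewrite mul0r mulr0.
have : `|a k * (N%:R / 2)| <= N%:R * M.
  rewrite E (le_trans (ler_norm_sum _ _ _)) //.
  rewrite (le_trans (ler_sum _ (_ : forall j, true -> _ <= M))) //.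
    move=> j _; rewrite normrM.
    exact: le_trans (ler_piMr (normr_ge0 _) (cos_max _)) (FM _).
  by rewrite sumr_const_nat subn0 mulr_natl.
rewrite normrM (gtr0_norm (_ : 0 < N%:R / 2)) ?divr_gt0 //.
by rewrite mulrCA ler_pM2l // ler_pdivrMr // mulrC.
Qed.

(** The constant term cancels; each of the [d] others contributes at most [2 M] from its coefficient
    times [d^2] from its frequency. *)
Lemma cos_sum_lipschitz (R : realType) (d : nat) (a : nat -> R) (M : R) :
    (forall t, `|\sum_(l < d.+1) a l * cos (l%:R * t)| <= M) ->
  forall s t,
  `|\sum_(l < d.+1) a l * cos (l%:R * s) - \sum_(l < d.+1) a l * cos (l%:R * t)|
    <= 2 * d%:R ^+ 3 * M * `|cos s - cos t|.
Proof.
move=> FM s t; rewrite -sumrB big_ord_recl /= !mul0r subrr add0r.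
rewrite (le_trans (ler_norm_sum _ _ _)) //.
have M0 : 0 <= M := le_trans (normr_ge0 _) (FM 0).
have B (i : 'I_d) : true -> `|a (bump 0 i) * cos ((bump 0 i)%:R * s) -
    a (bump 0 i) * cos ((bump 0 i)%:R * t)| <=
    2 * M * (d%:R ^+ 2 * `|cos s - cos t|).
  move=> _; rewrite -mulrBr normrM ler_pM // ?(cos_coef_le FM) ?ltn_ord //.
  rewrite (le_trans (normr_cos_natmulB _ _ _)) // ler_wpM2r //.
  by rewrite lerXn2r ?nnegrE // ler_nat ltn_ord.
rewrite (le_trans (ler_sum _ B)) // sumr_const card_ord -[leLHS]mulr_natl.
by rewrite le_eqVlt; apply/orP; left; apply/eqP; ring.
Qed.

(** * Chebyshev expansions in the variable [cos t] *)

Definition cos_span (R : realType) (d : nat) (f : R -> R) : Prop :=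
  exists a : nat -> R, forall t, f t = \sum_(l < d.+1) a l * cos (l%:R * t).

Lemma cos_span_sum (R : realType) (d : nat) (I : eqType) (r : seq I)
    (c : I -> R) (f : I -> R -> R) :
    {in r, forall i, cos_span d (f i)} ->
  cos_span d (fun t => \sum_(i <- r) c i * f i t).
Proof.
elim: r => [_|i r IH fr].
  by exists (fun=> 0) => t; rewrite big_nil big1 // => l _; rewrite mul0r.
have [a fa] := fr i (mem_head _ _).
have [|b fb] := IH; first by move=> j jr; apply: fr; rewrite inE jr orbT.
exists (fun l => c i * a l + b l) => t.
rewrite big_cons fa fb mulr_sumr -big_split /=.
by apply: eq_bigr => l _; rewrite mulrDl mulrA.
Qed.

Lemma cos_span_cos (R : realType) (d k : nat) :
  (k <= d)%N -> cos_span d (fun t : R => cos (k%:R * t)).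
Proof.
rewrite -ltnS => kd; exists (fun l => (l == k)%:R) => t.
rewrite (bigD1 (Ordinal kd)) //= eqxx mul1r big1 ?addr0 // => l.
by rewrite -val_eqE /= => /negPf ->; rewrite mul0r.
Qed.

(** Chebyshev recurrence: [2 cos t cos (l t) = cos ((l + 1) t) + cos ((l - 1) t)], with [l = 0]
    treated apart. *)
Lemma cos_span_cosM (R : realType) (d : nat) (f : R -> R) :
  cos_span d f -> cos_span d.+1 (fun t => cos t * f t).
Proof.
move=> [a fa].
have [b gb] : cos_span d.+1 (fun t : R => \sum_(l <- index_enum 'I_d.+1)
    a l * (cos t * cos (l%:R * t))).
  apply: cos_span_sum => -[[|l] /= ld] _.
    have [b fb] := @cos_span_cos R d.+1 1 isT.
    by exists b => t; rewrite -fb mul0r cos0 mulr1 mul1r.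
  (* The booleans index the two frequencies [l.+2] and [l], each with coefficient 1/2. *)
  have [|b fb] := @cos_span_sum R d.+1 bool [:: true; false] (fun=> 2^-1)
    (fun e t => cos ((if e then l.+2 else l)%:R * t)).
    by move=> [] _; apply: cos_span_cos; lia.
  exists b => t; rewrite -fb !big_cons big_nil addr0 -mulrDr.
  have -> : l.+2%:R * t = l.+1%:R * t + t by rewrite -[l.+2%:R]natr1; ring.
  have -> : l%:R * t = l.+1%:R * t - t by rewrite -natr1; ring.
  by rewrite cosD cosB; field.
exists b => t; rewrite -gb fa mulr_sumr.
by apply: eq_bigr => l _; rewrite mulrCA.
Qed.

Lemma cos_span_le (R : realType) (d e : nat) (f : R -> R) :
  (d <= e)%N -> cos_span d f -> cos_span e f.
Proof.
move=> de [a fa].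
have [|b gb] := @cos_span_sum R e 'I_d.+1 (index_enum 'I_d.+1) (fun l => a l)
  (fun l t => cos (l%:R * t)).
  by move=> l _; apply: cos_span_cos; rewrite (leq_trans (leq_ord l)).
by exists b => t; rewrite fa -gb.
Qed.

Lemma cos_span_cosX (R : realType) (d k : nat) :
  (k <= d)%N -> cos_span d (fun t : R => cos t ^+ k).
Proof.
move=> kd; apply: cos_span_le kd _; elim: k => [|k IH].
  have [b fb] := @cos_span_cos R 0 0 isT.
  by exists b => t; rewrite -fb mul0r cos0.
by have [b fb] := cos_span_cosM IH; exists b => t; rewrite -fb exprS.
Qed.

(** * Lipschitz bound for polynomials on the cube *)

Definition row_set (R : realType) (n : nat) (x : 'rV[R]_n) (i : 'I_n) (t : R) :
    'rV[R]_n :=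
  \row_j if j == i then t else x ord0 j.

(** Along a coordinate line a monomial [m] is a constant times [cos t ^+ m i], and [m i] is at most
    the total degree. *)
Lemma mpeval_row_set_cos_span (R : realType) (n d : nat) (p : {mpoly R[n]})
    (x : 'rV[R]_n) (i : 'I_n) :
  (msize p <= d.+1)%N -> cos_span d (fun t => mpeval p (row_set x i (cos t))).
Proof.
move=> dp.
have [|b fb] := @cos_span_sum R d 'X_{1..n} (msupp p)
  (fun m => p@_m * \prod_(j < n | j != i) x ord0 j ^+ m j)
  (fun m t => cos t ^+ m i).
  move=> m mp; apply: cos_span_cosX.
  have := leq_trans (msize_mdeg_lt mp) dp; rewrite ltnS; apply: leq_trans.
  by rewrite mdegE (bigD1 i) //= leq_addr.
exists b => t; rewrite -fb /mpeval mevalE; apply: eq_bigr => m _.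
rewrite (bigD1 i) //= mxE eqxx [X in _ * X]mulrC mulrA.
congr (_ * _ * _); apply: eq_bigr => j /negPf ji.
by rewrite mxE ji.
Qed.

Lemma cube_row_set (R : realType) (n : nat) (x : 'rV[R]_n) (i : 'I_n) (t : R) :
  cube x -> -1 <= t <= 1 -> cube (row_set x i t).
Proof. by move=> cx ct j; rewrite mxE; case: eqP => // _; apply: cx. Qed.

(** An integrated Markov inequality with a weaker constant: substituting [s = cos (acos s)] turns
    the restriction to a line into a cosine sum, bounded by [M] because the line segment stays in
    the cube. *)
Lemma mpeval_row_set_lipschitz (R : realType) (n d : nat) (p : {mpoly R[n]})
    (M : R) (x : 'rV[R]_n) (i : 'I_n) (s t : R) :
    (msize p <= d.+1)%N -> (forall z, cube z -> `|mpeval p z| <= M) ->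
    cube x -> -1 <= s <= 1 -> -1 <= t <= 1 ->
  `|mpeval p (row_set x i s) - mpeval p (row_set x i t)|
    <= 2 * d%:R ^+ 3 * M * `|s - t|.
Proof.
move=> dp pM cx cs ct; have [a pa] := mpeval_row_set_cos_span x i dp.
rewrite -(acosK (x := s)) ?in_itv //= -(acosK (x := t)) ?in_itv //= !pa.
apply: cos_sum_lipschitz => u; rewrite -pa; apply: pM.
by apply: cube_row_set => //; rewrite cos_geN1 cos_le1.
Qed.

Lemma normr_coord_le_norm2 (R : realType) (n : nat) (x : 'rV[R]_n) (i : 'I_n) :
  `|x ord0 i| <= norm2 x.
Proof.
rewrite -sqrtr_sqr /norm2 ler_sqrt ?sumr_ge0 // => [|j _]; last exact: sqr_ge0.
by rewrite (bigD1 i) //= lerDl sumr_ge0 // => j _; exact: sqr_ge0.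
Qed.

Lemma mpeval_lipschitz (R : realType) (n d : nat) (p : {mpoly R[n]})
    (M : R) (x y : 'rV[R]_n) :
    (msize p <= d.+1)%N -> (forall z, cube z -> `|mpeval p z| <= M) ->
    cube x -> cube y ->
  `|mpeval p x - mpeval p y| <= n%:R * (2 * d%:R ^+ 3 * M) * norm2 (x - y).
Proof.
move=> dp pM cx cy.
have M0 : 0 <= M := le_trans (normr_ge0 _) (pM _ cx).
(* A path from [y] to [x] changing one coordinate at a time; it stays in the cube, which is a
   product. *)
pose z (k : nat) : 'rV[R]_n :=
  \row_j if (j < k)%N then x ord0 j else y ord0 j.
have cz k : cube (z k) by move=> j; rewrite mxE; case: ifP.
have -> : mpeval p x - mpeval p y = mpeval p (z n) - mpeval p (z 0).
  by congr (mpeval p _ - mpeval p _); apply/rowP => j; rewrite mxE ?ltn_ord.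
rewrite -(telescope_sumr (fun k => mpeval p (z k))) // big_mkord.
rewrite (le_trans (ler_norm_sum _ _ _)) //.
have B (i : 'I_n) : true -> `|mpeval p (z i.+1) - mpeval p (z i)| <=
    2 * d%:R ^+ 3 * M * norm2 (x - y).
  move=> _.
  have -> : z i.+1 = row_set (z i) i (x ord0 i).
    apply/rowP => j; rewrite !mxE ltnS leq_eqVlt -val_eqE.
    by have [/= /val_inj ->|] := eqVneq.
  have {2}-> : z i = row_set (z i) i (y ord0 i).
    by apply/rowP => j; rewrite !mxE; have [->|//] := eqVneq; rewrite ltnn.
  rewrite (le_trans (mpeval_row_set_lipschitz _ dp pM _ _ _)) //.
  rewrite ler_wpM2l ?mulr_ge0 ?exprn_ge0 //.
  have -> : x ord0 i - y ord0 i = (x - y) ord0 i by rewrite !mxE.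
  exact: normr_coord_le_norm2.
rewrite (le_trans (ler_sum _ B)) // sumr_const card_ord -[leLHS]mulr_natl.
by rewrite [leLHS]mulrA.
Qed.

(** This makes the set in [supnorm] bounded above, so that its [sup] is a genuine upper bound. *)
Lemma mpeval_bounded (R : realType) (n : nat) (p : {mpoly R[n]})
    (x : 'rV[R]_n) :
  cube x -> `|mpeval p x| <= \sum_(m <- msupp p) `|p@_m|.
Proof.
move=> cx; rewrite /mpeval mevalE (le_trans (ler_norm_sum _ _ _)) //.
apply: ler_sum => m _; rewrite normrM ler_piMr // normr_prod.
by apply: prodr_ile1 => i _; rewrite normrX exprn_ge0 ?exprn_ile1 // ler_norml.
Qed.

Lemma normr_le_supnorm (R : realType) (n : nat) (p : {mpoly R[n]})
    (x : 'rV[R]_n) :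
  cube x -> `|mpeval p x| <= supnorm p.
Proof.
move=> cx; apply: ub_le_sup; last by exists x.
by exists (\sum_(m <- msupp p) `|p@_m|) => _ [z cz <-]; exact: mpeval_bounded.
Qed.

(** * Empirical means and transport *)

(** Grouping repeated points passes from averages over the sample to weighted sums over the support,
    on which couplings are defined. *)
Lemma sample_meanE (R : realType) (n : nat) (X : seq 'rV[R]_n)
    (f : 'rV[R]_n -> R) :
  (size X)%:R^-1 * \sum_(x <- X) f x = \sum_(x <- undup X) empirical X x * f x.
Proof.
rewrite /empirical; under [RHS]eq_bigr do rewrite -mulrA mulr_suml.
rewrite -mulr_sumr exchange_big /=; congr (_ * _).
rewrite big_seq [RHS]big_seq; apply: eq_bigr => y yX.
rewrite (bigD1_seq y) ?undup_uniq ?mem_undup //= eqxx mul1r big1 ?addr0 //.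
by move=> x /negPf xy; rewrite eq_sym xy mul0r.
Qed.

Lemma sum_empirical (R : realType) (n : nat) (X : seq 'rV[R]_n) :
  X != [::] -> \sum_(x <- undup X) empirical X x = 1.
Proof.
move=> X0; have := sample_meanE X (fun=> 1).
under [in RHS]eq_bigr do rewrite mulr1.
rewrite big_const_seq count_predT iter_addr_0 => <-.
by rewrite mulVf // pnatr_eq0 size_eq0.
Qed.

(** The easy half of Kantorovich duality: by the marginal conditions the difference equals the sum
    of [g x y * (f x - f y)]. *)
Lemma coupling_lipschitz (R : realType) (n : nat) (S T : seq 'rV[R]_n)
    (mu nu : 'rV[R]_n -> R) (g : 'rV[R]_n -> 'rV[R]_n -> R)
    (f : 'rV[R]_n -> R) (L : R) :
    coupling S T mu nu g ->
    {in S & T, forall x y, `|f x - f y| <= L * norm2 (x - y)} ->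
  `|\sum_(x <- S) mu x * f x - \sum_(y <- T) nu y * f y|
    <= L * transport_cost S T g.
Proof.
move=> [g0 gS gT] fL.
have -> : \sum_(x <- S) mu x * f x = \sum_(x <- S) \sum_(y <- T) g x y * f x.
  rewrite big_seq [RHS]big_seq; apply: eq_bigr => x xS.
  by rewrite -gS // mulr_suml.
have -> : \sum_(y <- T) nu y * f y = \sum_(x <- S) \sum_(y <- T) g x y * f y.
  rewrite exchange_big big_seq [RHS]big_seq /=; apply: eq_bigr => y yT.
  by rewrite -gT // mulr_suml.
rewrite -sumrB /transport_cost mulr_sumr (le_trans (ler_norm_sum _ _ _)) //.
rewrite big_seq [leRHS]big_seq; apply: ler_sum => x xS.
rewrite -sumrB mulr_sumr (le_trans (ler_norm_sum _ _ _)) //.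
rewrite big_seq [leRHS]big_seq; apply: ler_sum => y yT.
by rewrite -mulrBr normrM ger0_norm ?g0 // mulrCA ler_wpM2l ?g0 ?fL.
Qed.

(** Existence of a coupling keeps the infimum in [wasserstein] from being taken over the empty
    set. *)
Lemma product_coupling (R : realType) (n : nat) (X Y : seq 'rV[R]_n) :
    X != [::] -> Y != [::] ->
  coupling (undup X) (undup Y) (empirical X) (empirical Y)
    (fun x y => empirical X x * empirical Y y).
Proof.
move=> X0 Y0.
have e0 (Z : seq 'rV[R]_n) z : 0 <= empirical Z z.
  by rewrite mulr_ge0 ?invr_ge0 // sumr_ge0.
split=> [x y _ _|x _|y _]; first by rewrite mulr_ge0.
  by rewrite -mulr_sumr sum_empirical ?mulr1.
by rewrite -mulr_suml sum_empirical ?mul1r.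
Qed.

Lemma sample_mean_lipschitz (R : realType) (n : nat) (X Y : seq 'rV[R]_n)
    (f : 'rV[R]_n -> R) (L : R) :
    X != [::] -> Y != [::] -> 0 <= L ->
    {in X & Y, forall x y, `|f x - f y| <= L * norm2 (x - y)} ->
  `|(size X)%:R^-1 * (\sum_(x <- X) f x) - (size Y)%:R^-1 * (\sum_(y <- Y) f y)|
    <= L * wasserstein X Y.
Proof.
move=> X0 Y0 L0 fL; rewrite !sample_meanE.
have cL g : coupling (undup X) (undup Y) (empirical X) (empirical Y) g ->
    `|\sum_(x <- undup X) empirical X x * f x -
      \sum_(y <- undup Y) empirical Y y * f y|
      <= L * transport_cost (undup X) (undup Y) g.
  move=> cg; apply: (coupling_lipschitz cg) => x y.
  by rewrite !mem_undup; apply: fL.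
have cXY := product_coupling X0 Y0.
(* For [L > 0] one divides by [L] to get a lower bound of all transport costs; for [L = 0] the
   product coupling already gives the claim. *)
move: L0; rewrite le_eqVlt => /predU1P[L0|L0].
  by have := cL _ cXY; rewrite -L0 !mul0r.
rewrite -ler_pdivrMl //; apply: lb_le_inf.
  by eexists; exists (fun x y => empirical X x * empirical Y y).
by move=> _ [g cg <-]; rewrite ler_pdivrMl //; exact: cL.
Qed.

(** * Reproducing kernels and comparison of Christoffel polynomials *)

Lemma innerZl (R : realType) (n : nat) (X : seq 'rV[R]_n) (c : R)
    (p q : {mpoly R[n]}) :
  inner X (c *: p) q = c * inner X p q.
Proof.
by have := inner_suml X q [:: tt] (fun=> c) (fun=> p); rewrite !big_seq1.
Qed.

Lemma inner_ge0 (R : realType) (n : nat) (X : seq 'rV[R]_n) (p : {mpoly R[n]}) :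
  0 <= inner X p p.
Proof.
by rewrite mulr_ge0 ?invr_ge0 // sumr_ge0 // => x _; rewrite -expr2 sqr_ge0.
Qed.

Lemma mpeval_sum (R : realType) (n : nat) (x : 'rV[R]_n) (I : Type)
    (r : seq I) (p : I -> {mpoly R[n]}) :
  mpeval (\sum_(i <- r) p i) x = \sum_(i <- r) mpeval (p i) x.
Proof. exact: raddf_sum. Qed.

(** The witness is the kernel [u = \sum_a b_a(x) b_a]; its value at [x] is the sum of the squares
    [b_a(x)^2]. *)
Lemma christoffel_kernel (R : realType) (n d : nat) (X : seq 'rV[R]_n)
    (x : 'rV[R]_n) :
    nondegenerate_sample X d ->
  exists u : {mpoly R[n]},
    [/\ (msize u <= d.+1)%N, mpeval u x = mpeval (christoffel X d) x
      & forall q, (msize q <= d.+1)%N -> inner X u q = mpeval q x].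
Proof.
move=> /orthonormal_basis_exists[b bb]; have [bd _ _] := bb.
exists (\sum_a mpeval (b a) x *: b a); split.
- rewrite (leq_trans (msize_sum _ _ _)) //; apply/bigmax_leqP => a _.
  exact: leq_trans (msizeZ_le _ _) (bd a).
- rewrite (christoffelE bb) !mpeval_sum; apply: eq_bigr => a _.
  by rewrite expr2 /mpeval mevalZ mevalM.
- move=> q qd; rewrite inner_suml [in RHS](orthonormal_coord bb qd) mpeval_sum.
  by apply: eq_bigr => a _; rewrite /mpeval mevalZ mulrC inner_sym.
Qed.

(** Cauchy-Schwarz for [q(x) = <u,q>], where [<u,u> = u(x)] is the Christoffel value. *)
Lemma sqr_mpeval_le (R : realType) (n d : nat) (X : seq 'rV[R]_n)
    (q : {mpoly R[n]}) (x : 'rV[R]_n) :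
    nondegenerate_sample X d -> (msize q <= d.+1)%N ->
  mpeval q x ^+ 2 <= inner X q q * mpeval (christoffel X d) x.
Proof.
move=> ndX qd; have [u [ud <- uP]] := christoffel_kernel x ndX.
rewrite -(uP u ud) -(uP q qd).
have [->|u0] := eqVneq u 0.
  by rewrite -[0](scale0r 0) !innerZl !mul0r expr0n mulr0.
have s0 := ndX u ud u0.
(* Cauchy-Schwarz: expand [<w,w> >= 0]. *)
pose w := inner X u u *: q + - inner X u q *: u.
have wd : (msize w <= d.+1)%N.
  rewrite (leq_trans (msizeD_le _ _)) // geq_max.
  by rewrite !(leq_trans (msizeZ_le _ _)).
have wE z : inner X w z = inner X u u * inner X q z - inner X u q * inner X u z.
  by rewrite inner_lin innerZl mulNr.
have : 0 <= inner X w w by exact: inner_ge0.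
rewrite wE [inner X u w]inner_sym [inner X q w]inner_sym !wE.
rewrite [inner X q u]inner_sym [_ * inner X u u]mulrC subrr mulr0 subr0.
by rewrite pmulr_rge0 // subr_ge0 [leRHS]mulrC -expr2.
Qed.

(** The pointwise bound at [q = 1] reads [1 <= <1,1> P(x)]. *)
Lemma christoffel_gt0 (R : realType) (n d : nat) (X : seq 'rV[R]_n)
    (x : 'rV[R]_n) :
  nondegenerate_sample X d -> 0 < mpeval (christoffel X d) x.
Proof.
move=> ndX; have d1 : (msize (1 : {mpoly R[n]}) <= d.+1)%N by rewrite msize1.
have := sqr_mpeval_le x ndX d1; rewrite {1}/mpeval meval1 expr1n => h.
by rewrite -(pmulr_rgt0 _ (ndX 1 d1 (oner_neq0 _))) (lt_le_trans ltr01).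
Qed.

Lemma nondegenerate_sample_neq0 (R : realType) (n d : nat)
    (X : seq 'rV[R]_n) :
  nondegenerate_sample X d -> X != [::].
Proof.
move=> ndX; apply/eqP => X0; have := ndX 1; rewrite msize1 oner_neq0.
by rewrite /inner X0 big_nil mulr0 ltxx => /(_ isT isT).
Qed.

Lemma christoffel_perturbation (R : realType) (n d : nat)
    (X Y : seq 'rV[R]_n) (e : R) (x : 'rV[R]_n) :
    nondegenerate_sample X d -> nondegenerate_sample Y d ->
    (forall q : {mpoly R[n]}, (msize q <= d.+1)%N ->
      `|inner X q q - inner Y q q| <= e * inner X q q) ->
  `|mpeval (christoffel X d) x - mpeval (christoffel Y d) x|
    <= e * mpeval (christoffel Y d) x.
Proof.
move=> ndX ndY XY.
have X0 := christoffel_gt0 x ndX; have Y0 := christoffel_gt0 x ndY.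
have [u [ud ux uP]] := christoffel_kernel x ndX.
have [v [vd vx vP]] := christoffel_kernel x ndY.
have uX := uP u ud; have vY := vP v vd.
have uY := sqr_mpeval_le x ndY ud; have vX := sqr_mpeval_le x ndX vd.
have := XY u ud; have := XY v vd.
rewrite !ler_norml; move: X0 Y0 uX vY uY vX; rewrite ux vx.
set P := mpeval (christoffel X d) x; set Q := mpeval (christoffel Y d) x.
move: (inner X u u) (inner Y u u) (inner X v v) (inner Y v v).
move=> Xu Yu Xv Yv P0 Q0 -> -> uY vX /andP[v1 v2] /andP[u1 u2].
(* Testing with [u]: [P^2 <= <u,u>_Y Q <= (1 + e) P Q]. *)
have PQ : P <= (1 + e) * Q.
  rewrite -(ler_pM2l P0) -expr2 (le_trans uY) // mulrA ler_wpM2r ?(ltW Q0) //.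
  by lra.
apply/andP; split; last lra.
(* If [e >= 1], the lower bound follows from [P > 0]. Otherwise test with [v]:
   [(1 - e) Q^2 <= (1 - e) <v,v>_X P <= Q P]. *)
have [e1|e1] := leP 1 e; first by nra.
have : Q * ((1 - e) * Q) <= Q * P.
  have : (1 - e) * Xv * P <= Q * P by rewrite ler_wpM2r ?(ltW P0) //; lra.
  apply: le_trans; rewrite mulrCA -expr2 -mulrA ler_wpM2l //; lra.
by rewrite ler_pM2l //; lra.
Qed.

(** * The explicit constant and the conclusion *)

(** By Pascal's rule, each increment of [n] adds a binomial coefficient at least [d]. *)
Lemma leq_mul_bin (n d : nat) : (n * d <= 'C(n + d, d))%N.
Proof.
elim: n => [|n IH] //; case: d IH => [|d] IH; first by rewrite muln0.
rewrite addSn binS mulSn addnC leq_add //.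
by rewrite -{1}binSn leq_bin2l // leq_addl.
Qed.

Lemma inner_wasserstein (R : realType) (n d : nat) (X Y : seq 'rV[R]_n)
    (q : {mpoly R[n]}) :
    (forall x, x \in X -> cube x) -> (forall y, y \in Y -> cube y) ->
    nondegenerate_sample X d -> nondegenerate_sample Y d ->
    (msize q <= d.+1)%N ->
  `|inner X q q - inner Y q q| <=
    (4 * 'C(n + d, d)%:R * d%:R ^+ 2) * supnorm (christoffel X d)
      * wasserstein X Y * inner X q q.
Proof.
move=> hX hY ndX ndY qd.
(* By the pointwise bound, [M] dominates [|q|] on the cube. *)
pose M : R := Num.sqrt (inner X q q * supnorm (christoffel X d)).
have M0 : 0 <= M by exact: sqrtr_ge0.
have P0 : 0 <= supnorm (christoffel X d).
  have := nondegenerate_sample_neq0 ndX; case: X hX {ndX M M0} => // x X hX _.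
  exact: le_trans (normr_ge0 _) (normr_le_supnorm _ (hX x (mem_head _ _))).
have M2 : M ^+ 2 = inner X q q * supnorm (christoffel X d).
  by rewrite sqr_sqrtr // mulr_ge0 ?inner_ge0.
have qM z : cube z -> `|mpeval q z| <= M.
  move=> cz; rewrite -sqrtr_sqr ler_sqrt; last by rewrite mulr_ge0 ?inner_ge0.
  rewrite (le_trans (sqr_mpeval_le z ndX qd)) // ler_wpM2l ?inner_ge0 //.
  exact: le_trans (ler_norm _) (normr_le_supnorm _ cz).
(* The factor in front of [wasserstein X Y] becomes [4 C(n + d, d) d^2 M^2], to be shown a Lipschitz
   constant of [q^2]. *)
rewrite mulrAC -[_ * _ * inner X q q]mulrA [_ * inner X q q]mulrC -M2.
apply: sample_mean_lipschitz.
- exact: nondegenerate_sample_neq0 ndX.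
- exact: nondegenerate_sample_neq0 ndY.
- by rewrite !mulr_ge0 ?exprn_ge0.
move=> x y xX yY; rewrite -!expr2 subr_sqr normrM.
have cx := hX x xX; have cy := hY y yY.
have s2 : `|mpeval q x + mpeval q y| <= 2 * M.
  by rewrite (le_trans (ler_normD _ _)) // mulr_natl lerD ?qM.
have s1 := mpeval_lipschitz qd qM cx cy.
rewrite (le_trans (ler_pM _ _ s1 s2)) //.
(* One of the three factors [d] joins [n], so that [n d] can be bounded by the binomial
   coefficient. *)
have -> : n%:R * (2 * d%:R ^+ 3 * M) * norm2 (x - y) * (2 * M) =
  4 * (n * d)%:R * d%:R ^+ 2 * M ^+ 2 * norm2 (x - y).
  by rewrite natrM; ring.
by rewrite !ler_wpM2r ?sqrtr_ge0 ?exprn_ge0 // ler_wpM2l // ler_nat leq_mul_bin.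
Qed.

Unset Implicit Arguments.

Theorem theorem16 (R : realType) (n d : nat) (hn : (1 <= n)%N)
    (X Y : seq 'rV[R]_n)
    (hX : forall x, x \in X -> cube x) (hY : forall y, y \in Y -> cube y)
    (ndX : nondegenerate_sample X d) (ndY : nondegenerate_sample Y d) (x : 'rV[R]_n) :
  `|mpeval (christoffel X d) x - mpeval (christoffel Y d) x| <=
    (4 * 'C(n + d, d)%:R * d%:R ^+ 2) * supnorm (christoffel X d)
      * wasserstein X Y * mpeval (christoffel Y d) x.
Proof.
apply: christoffel_perturbation => // q qd.
exact: inner_wasserstein.
Qed.
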